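(* Let $(X,\Sigma,\mu)$ be a probability space such that $L^1(\mu)$ is separable, and let $\mathcal{DS}(\mu)$ be the set of all doubly stochastic operators on $L^1(\mu)$. Then the set $\{T\in\mathcal{DS}(\mu): h(T)=0\}$ of doubly stochastic operators with zero entropy is residual in $\mathcal{DS}(\mu)$, both with respect to the strong operator topology and with respect to the operator norm topology of $L^1(\mu)$.
   Context: A doubly stochastic operator is a linear operator $T$ on $L^1(\mu)$ such that: (i) $Tf$ is positive for every positive $f\in L^1(\mu)$; (ii) $T\mathbb{1}=\mathbb{1}$, where $\mathbb{1}(x)=1$ for all $x\in X$; (iii) $\int Tf\,d\mu=\int f\,d\mu$ for every $f\in L^1(\mu)$. The strong operator topology is the topology of pointwise convergence: $T_n\to T$ iff $\|T_nf-Tf\|_1\to 0$ for each $f\in L^1(\mu)$. $\mathcal{DS}(\mu)$ carries the subspace topologies. Entropy. A collection is a finite sequence of measurable functions $X\to[0,1]$. For measurable $f:X\to[0,1]$ let $A_f=\{(x,t)\in X\times[0,1]: t\le f(x)\}$ and let $\mathscr{A}_f$ be the partition of $X\times[0,1]$ into $A_f$ and its complement. For a collection $\mathcal{F}$ let $\mathscr{A}_{\mathcal{F}}=\bigvee_{f\in\mathcal{F}}\mathscr{A}_f$ (common refinement) and, with $\lambda$ the Lebesgue measure on $[0,1]$, let $H(\mathcal{F})=-\sum_{A\in\mathscr{A}_{\mathcal{F}}}(\mu\times\lambda)(A)\log(\mu\times\lambda)(A)$. Write $T^n\mathcal{F}=\{T^nf: f\in\mathcal{F}\}$, and let $\mathcal{F}^n_T$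 be the concatenation of $\mathcal{F},T\mathcal{F},\dots,T^{n-1}\mathcal{F}$. Put $h(T,\mathcal{F})=\lim_{n\to\infty}\frac1n H(\mathcal{F}^n_T)$ (the limit is known to exist) and $h(T)=\sup_{\mathcal{F}}h(T,\mathcal{F})$, the supremum being over all collections. *)

(* Defs.v *)
From HB Require Import structures.
From mathcomp Require Import all_boot all_order all_algebra generic_quotient.
From mathcomp Require Import all_classical all_reals all_analysis.
From mathcomp Require Import measurable_realfun borel_hierarchy.
Import Order.TTheory GRing.Theory Num.Theory numFieldNormedType.Exports.

Set Implicit Arguments.
Unset Strict Implicit.
Unset Printing Implicit Defensive.

Local Open Scope classical_set_scope.
Local Open Scope ring_scope.

(* [LspaceType1 mu] is only a type in the library; the vector space structure
   and the norm of L^1(mu) are transported from the integrable functions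
   [LfunType mu (lexx 1%E)]. *)
Section L1_space.
Context d (X : measurableType d) (R : realType).
Variable mu : {measure set X -> \bar R}.
Local Notation Lfun1 := (LfunType mu (lexx 1%E)).
Local Notation L1 := (LspaceType1 mu).
Local Notation Q := {mfun_ mu, X >-> measurableTypeR R}.
Local Open Scope quotient_scope.

HB.instance Definition _ := gen_eqMixin L1.
HB.instance Definition _ := gen_choiceMixin L1.

(* {mfun X >-> R} and {mfun X >-> measurableTypeR R} differ by the display
   only, hence the two rebuilt structures below. *)
Section L1_class.
Variable f : Lfun1.

Lemma Lfun_measurableTypeR :
  @measurable_fun _ _ X (measurableTypeR R) [set: X] f.
Proof. exact: (@measurable_funPT _ _ _ _ f). Qed.

Definition mfun_of_Lfun : {mfun X >-> measurableTypeR R} :=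
  MeasurableFun.Pack (MeasurableFun.Class
    (isMeasurableFun.Build _ _ X (measurableTypeR R) f Lfun_measurableTypeR)).

Definition aeEqMfun_of_Lfun : Q := \pi_Q mfun_of_Lfun.

Lemma pi_Lfun_ae : aeEqMfun_of_Lfun = f %[ae mu].
Proof.
have : repr (\pi_Q mfun_of_Lfun) = mfun_of_Lfun %[mod Q] by rewrite reprK.
by move=> /eqmodP/asboolP.
Qed.

Lemma measurable_pi_Lfun : measurable_fun [set: X] aeEqMfun_of_Lfun.
Proof. exact: (@measurable_funPT _ _ _ _ (repr (\pi_Q mfun_of_Lfun))). Qed.

Lemma pi_Lfun_finite : finite_norm mu 1 aeEqMfun_of_Lfun.
Proof.
rewrite /finite_norm Lnorm1.
rewrite (_ : (\int[mu]_x _)%E = \int[mu]_x `|(EFin \o f) x|)%E; last first.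
  apply: ge0_ae_eq_integral => //.
  - by apply: measurableT_comp => //; exact/measurable_EFinP/measurable_pi_Lfun.
  - by apply: measurableT_comp => //; exact/measurable_EFinP.
  - by apply: filterS pi_Lfun_ae => x /= H /H ->.
by rewrite -Lnorm1; exact: Lfunction_finite.
Qed.

Definition L1_class : L1 :=
  LebesgueSpace.Pack (LebesgueSpace.Class
    (isFinLebesgue.Build _ _ _ _ _ _ aeEqMfun_of_Lfun pi_Lfun_finite)).

Lemma L1_classE : L1_class = f %[ae mu].
Proof. exact: pi_Lfun_ae. Qed.

End L1_class.

Section L1_repr.
Variable u : L1.

Lemma measurable_L1 : measurable_fun [set: X] (u : X -> R).
Proof. exact: (@measurable_funPT _ _ _ _ (repr (u : Q))). Qed.

Lemma L1_finite_norm : finite_norm mu 1 u.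
Proof. by case: u => ? [[]]. Qed.

Lemma L1_Lfun : (u : X -> R) \in Lfun mu 1.
Proof.
by apply/andP; split; apply/mem_set; [exact: measurable_L1|exact: L1_finite_norm].
Qed.

Definition L1_repr : Lfun1 := Lfun_Sub (lexx 1%E) L1_Lfun.

Lemma L1_integrable : mu.-integrable [set: X] (EFin \o u).
Proof. exact/Lfun1_integrable/(LfunP L1_repr). Qed.

End L1_repr.

Lemma L1P (u v : L1) : u = v %[ae mu] -> u = v.
Proof.
move=> uv; have : repr (u : Q) = repr (v : Q) %[mod Q].
  by apply/eqmodP/asboolP.
rewrite !reprK; case: u v {uv} => [u [[fu]]] [v [[fv]]] /= uv.
by case: _ / uv in fv *; rewrite (Prop_irrelevance fu fv).
Qed.

Lemma L1_reprK : cancel L1_repr L1_class.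
Proof. by move=> u; apply: L1P; exact: L1_classE. Qed.

Definition L1_zero : L1 := L1_class 0.
Definition L1_opp (u : L1) : L1 := L1_class (- L1_repr u).
Definition L1_add (u v : L1) : L1 := L1_class (L1_repr u + L1_repr v).
Definition L1_scale (a : R) (u : L1) : L1 := L1_class (a *: L1_repr u).

Lemma L1_zeroE : \forall x \ae mu, L1_zero x = 0.
Proof. by apply: filterS (L1_classE 0) => x /(_ I) ->. Qed.

Lemma L1_oppE u : \forall x \ae mu, L1_opp u x = - u x.
Proof. by apply: filterS (L1_classE (- L1_repr u)) => x /(_ I) ->. Qed.

Lemma L1_addE u v : \forall x \ae mu, L1_add u v x = u x + v x.
Proof. by apply: filterS (L1_classE (L1_repr u + L1_repr v)) => x /(_ I) ->. Qed.

Lemma L1_scaleE a u : \forall x \ae mu, L1_scale a u x = a * u x.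
Proof. by apply: filterS (L1_classE (a *: L1_repr u)) => x /(_ I) ->. Qed.

Lemma L1_addA : associative L1_add.
Proof.
move=> u v w; apply: L1P; near=> x => _.
rewrite (near (L1_addE u (L1_add v w)) x)// (near (L1_addE v w) x)//.
rewrite (near (L1_addE (L1_add u v) w) x)// (near (L1_addE u v) x)//.
by rewrite addrA.
Unshelve. all: by end_near. Qed.

Lemma L1_addC : commutative L1_add.
Proof. by move=> u v; rewrite /L1_add addrC. Qed.

Lemma L1_add0 : left_id L1_zero L1_add.
Proof.
move=> u; apply: L1P; near=> x => _.
rewrite (near (L1_addE L1_zero u) x)// (near L1_zeroE x)//.
by rewrite add0r.
Unshelve. all: by end_near. Qed.

Lemma L1_addN : left_inverse L1_zero L1_opp L1_add.
Proof.
move=> u; apply: L1P; near=> x => _.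
rewrite (near (L1_addE (L1_opp u) u) x)// (near (L1_oppE u) x)//.
by rewrite (near L1_zeroE x)// addNr.
Unshelve. all: by end_near. Qed.

HB.instance Definition _ :=
  GRing.isZmodule.Build L1 L1_addA L1_addC L1_add0 L1_addN.

Lemma L1_scaleA a b u : L1_scale a (L1_scale b u) = L1_scale (a * b) u.
Proof.
apply: L1P; near=> x => _.
rewrite (near (L1_scaleE a (L1_scale b u)) x)// (near (L1_scaleE b u) x)//.
by rewrite (near (L1_scaleE (a * b) u) x)// mulrA.
Unshelve. all: by end_near. Qed.

Lemma L1_scale1 : left_id 1 L1_scale.
Proof.
by move=> u; rewrite /L1_scale scale1r L1_reprK.
Qed.

Lemma L1_scaleDr : right_distributive L1_scale L1_add.
Proof.
move=> a u v; apply: L1P; near=> x => _.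
rewrite (near (L1_scaleE a (L1_add u v)) x)// (near (L1_addE u v) x)//.
rewrite (near (L1_addE (L1_scale a u) (L1_scale a v)) x)//.
by rewrite (near (L1_scaleE a u) x)// (near (L1_scaleE a v) x)// mulrDr.
Unshelve. all: by end_near. Qed.

Lemma L1_scaleDl u : {morph L1_scale^~ u : a b / a + b >-> L1_add a b}.
Proof.
move=> a b; apply: L1P; near=> x => _.
rewrite (near (L1_scaleE (a + b) u) x)//.
rewrite (near (L1_addE (L1_scale a u) (L1_scale b u)) x)//.
by rewrite (near (L1_scaleE a u) x)// (near (L1_scaleE b u) x)// mulrDl.
Unshelve. all: by end_near. Qed.

HB.instance Definition _ := GRing.Zmodule_isLmodule.Build R L1
  L1_scaleA L1_scale1 L1_scaleDr L1_scaleDl.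

Definition L1_norm (u : L1) : R := fine 'N[mu]_1[EFin \o u]%E.

Lemma L1_norm_class (f : Lfun1) : L1_norm (L1_class f) = fine 'N[mu]_1[EFin \o f]%E.
Proof.
rewrite /L1_norm !Lnorm1; congr fine; apply: ge0_ae_eq_integral => //.
- by apply: measurableT_comp => //; exact/measurable_EFinP/measurable_L1.
- by apply: measurableT_comp => //; exact/measurable_EFinP.
- by apply: filterS (L1_classE f) => x /= H /H ->.
Qed.

Lemma L1_normD (u v : L1) : L1_norm (u + v) <= L1_norm u + L1_norm v.
Proof.
rewrite -[u + v]/(L1_class (L1_repr u + L1_repr v)) L1_norm_class.
exact: (ler_LnormD (L1_repr u) (L1_repr v)).
Qed.

Lemma L1_normZ (a : R) (u : L1) : L1_norm (a *: u) = `|a| * L1_norm u.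
Proof.
rewrite -[a *: u]/(L1_class (a *: L1_repr u)) L1_norm_class.
have /(congr1 fine) := LnormZ (L1_repr u) a.
by rewrite fineM// -finite_norm_fine.
Qed.

Lemma L1_norm0_eq0 (u : L1) : L1_norm u = 0 -> u = 0.
Proof.
move=> /(@fine_Lnormr_eq0 _ _ _ _ _ _ (L1_repr u)) u0; apply: L1P.
near=> x => _; rewrite [RHS](near L1_zeroE x)//.
by apply: (near u0 x).
Unshelve. all: by end_near. Qed.

HB.instance Definition _ := Lmodule_isNormed.Build R L1
  L1_normD L1_normZ L1_norm0_eq0.

Lemma EFin_L1_norm (u : L1) : `|u|%:E = (\int[mu]_x `|(u x)%:E|)%E.
Proof.
by rewrite -[LHS]/(L1_norm u)%:E (finite_norm_fine (L1_repr u)) Lnorm1.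
Qed.

Lemma L1_normE (u : L1) : `|u| = \int[mu]_x `|u x|.
Proof. by rewrite -[LHS]/(L1_norm u) /L1_norm Lnorm1. Qed.

End L1_space.

Section doubly_stochastic.
Context d (X : measurableType d) (R : realType) (mu : probability X R).
Local Notation L1 := (LspaceType1 mu).

Definition L1_one : L1 := L1_class (Lfun_Sub (lexx 1%E) (Lfun_cst mu 1 1)).

Definition doubly_stochastic (T : L1 -> L1) : Prop :=
  [/\ linear T,
      forall f : L1, (\forall x \ae mu, 0 <= f x) ->
        \forall x \ae mu, 0 <= T f x,
      T L1_one = L1_one &
      forall f : L1, \int[mu]_x T f x = \int[mu]_x f x].

Record DS := MkDS { DS_fun :> L1 -> L1 ; DS_ds : doubly_stochastic DS_fun }.

HB.instance Definition _ := gen_eqMixin DS.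
HB.instance Definition _ := gen_choiceMixin DS.

Lemma DS_inj (S T : DS) : S =1 T -> S = T.
Proof.
case: S T => S dS [T dT] /= /funext ST; case: _ / ST in dT *.
by rewrite (Prop_irrelevance dS dT).
Qed.

(* Subspace topology induced by pointwise convergence in L^1-norm. *)
Definition DS_strong : Type :=
  initial_topology (fun T : DS => (T : L1 -> L1) : {ptws L1 -> L1}).
HB.instance Definition _ := Topological.on DS_strong.

(* [sup] is 0 on unbounded sets; here it is only taken of differences of
   elements of DS, which are contractions by [DS_contraction]. *)
Definition op_norm (A : L1 -> L1) : R :=
  sup [set `|A f| | f in [set f : L1 | `|f| <= 1]].

Definition DS_norm : Type := DS.
HB.instance Definition _ := Choice.on DS_norm.
Definition DS_dist (S T : DS_norm) : R := op_norm (fun f => S f - T f).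

Lemma DS_contraction (T : DS) (f : L1) : `|T f| <= `|f|.
Proof.
case: T => T [linT T0 _ intT] /=.
pose LT : {linear L1 -> L1} := HB.pack T (GRing.isLinear.Build _ _ _ _ T linT).
pose af : L1 := L1_class (Lfun_Sub (lexx 1%E) (Lfun_norm (L1_Lfun f))).
have afE : \forall x \ae mu, af x = `|f x|.
  by have := L1_classE (Lfun_Sub (lexx 1%E) (Lfun_norm (L1_Lfun f))); apply: filterS => x /(_ I).
have TB : \forall x \ae mu, 0 <= (T (af - f)) x.
  apply: T0; near=> x. 
  rewrite [X in 0 <= X](near (L1_addE af (- f)) x)//.
  rewrite [X in _ + X](near (L1_oppE f) x)// (near afE x)//.
  by rewrite subr_ge0 ler_norm.
have TD : \forall x \ae mu, 0 <= (T (af + f)) x.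
  apply: T0; near=> x. 
  rewrite [X in 0 <= X](near (L1_addE af f) x)//.
  rewrite (near afE x)//.
  by rewrite -lerBlDr sub0r -normrN ler_norm.
have {}TB : \forall x \ae mu, 0 <= (T af - T f) x.
  by rewrite -(raddfB LT).
have {}TD : \forall x \ae mu, 0 <= (T af + T f) x.
  by rewrite -(raddfD LT).
have Taf0 : \forall x \ae mu, 0 <= T af x.
  by apply: T0; apply: filterS afE => x ->.
have Tle : \forall x \ae mu, `|T f x| <= T af x.
  near=> x; rewrite ler_norml lerNl -subr_ge0 -[X in _ && X]subr_ge0; apply/andP; split.
    rewrite opprK; have : 0 <= (T af + T f) x by apply: (near TD x).
    by rewrite [X in 0 <= X -> _](near (L1_addE (T af) (T f)) x).
  have : 0 <= (T af - T f) x by apply: (near TB x).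
  rewrite [X in 0 <= X -> _](near (L1_addE (T af) (- T f)) x)//.
  by rewrite [X in 0 <= _ + X -> _](near (L1_oppE (T f)) x).
have mEFin (u : L1) : measurable_fun [set: X] (EFin \o u).
  by apply/measurable_EFinP; exact: measurable_L1.
have mabs (u : L1) : measurable_fun [set: X] (fun x => `|(u x)%:E|%E).
  by apply: measurableT_comp => //; exact: mEFin.
rewrite -lee_fin (@le_trans _ _ `|T af|%:E)//.
  rewrite !EFin_L1_norm; apply: ae_ge0_le_integral => //.
  apply: filterS Tle => x + _; rewrite !abse_EFin lee_fin => /le_trans; apply.
  exact: ler_norm.
rewrite !L1_normE lee_fin.
have -> : \int[mu]_x `|T af x| = \int[mu]_x T af x.
  rewrite /Rintegral; congr fine; apply: ae_eq_integral => //; [exact: mabs|exact: mEFin|].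
  by apply: filterS Taf0 => x + _; move=> /ger0_norm ->.
rewrite intT /Rintegral le_eqVlt; apply/orP; left; apply/eqP; congr fine.
apply: ae_eq_integral => //; [exact: mEFin|exact: mabs|].
by apply: filterS afE => x -> _.
Unshelve. all: by end_near. Qed.

Lemma DS_dist_le2 (S T : DS) (f : L1) : `|f| <= 1 -> `|S f - T f| <= 2.
Proof.
move=> f1; rewrite (le_trans (ler_normB _ _))// -[2]/(1 + 1) lerD//.
  exact: le_trans (DS_contraction S f) f1.
exact: le_trans (DS_contraction T f) f1.
Qed.

Lemma DS_dist_ub (S T : DS) (f : L1) : `|f| <= 1 -> `|S f - T f| <= DS_dist S T.
Proof.
move=> f1; apply: ub_le_sup; last by exists f.
by exists 2 => _ [g g1 <-]; exact: DS_dist_le2.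
Qed.

Lemma DS_dist_le (S T : DS) (c : R) :
  (forall f : L1, `|f| <= 1 -> `|S f - T f| <= c) -> DS_dist S T <= c.
Proof.
move=> ST; apply: ge_sup; last by move=> _ [f f1 <-]; exact: ST.
by exists `|S 0 - T 0|; exists 0 => //=; rewrite normr0.
Qed.

Lemma DS_distxx (T : DS) : DS_dist T T = 0.
Proof.
apply/eqP; rewrite eq_le; apply/andP; split.
  by apply: DS_dist_le => f _; rewrite subrr normr0.
apply: le_trans (@DS_dist_ub T T 0 _); first exact: normr_ge0.
by rewrite normr0.
Qed.

Lemma DS_dist_sym (S T : DS) : DS_dist S T = DS_dist T S.
Proof.
by rewrite /DS_dist /op_norm; congr sup; apply: eq_imagel => f _; exact: distrC.
Qed.

Lemma DS_dist_triangle (T S U : DS) : DS_dist S U <= DS_dist S T + DS_dist T U.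
Proof.
apply: DS_dist_le => f f1; rewrite (le_trans (ler_distD (T f) _ _))//.
by rewrite lerD// DS_dist_ub.
Qed.

Lemma DS_dist_eq0 (S T : DS) : DS_dist S T = 0 -> S = T.
Proof.
move=> ST0; apply: DS_inj => f.
have [->|f0] := eqVneq f 0.
  by apply/eqP; rewrite -subr_eq0 -normr_le0 -ST0 DS_dist_ub// normr0.
have nf0 : `|f| != 0 by rewrite normr_eq0.
have : `|S (`|f|^-1 *: f) - T (`|f|^-1 *: f)| <= 0.
  by rewrite -ST0 DS_dist_ub// normrZ normfV normr_id mulVf.
have [linS _ _ _] := DS_ds S; have [linT _ _ _] := DS_ds T.
pose LS : {linear L1 -> L1} := HB.pack (S : L1 -> L1)
  (GRing.isLinear.Build _ _ _ _ (S : L1 -> L1) linS).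
pose LT : {linear L1 -> L1} := HB.pack (T : L1 -> L1)
  (GRing.isLinear.Build _ _ _ _ (T : L1 -> L1) linT).
rewrite -[S _]/(LS _) -[T _]/(LT _) !linearZ/= -scalerDr normr_le0.
by rewrite scaler_eq0 invr_eq0 (negbTE nf0)/= subr_eq0 => /eqP.
Qed.

(* The topology induced on DS by the operator norm. *)
HB.instance Definition _ := isMetric.Build R DS_norm
  DS_distxx DS_dist_eq0 DS_dist_sym DS_dist_triangle.

Local Notation XI := (set (X * measurableTypeR R)).

Definition strip : XI := [set z | 0 <= z.2 <= 1].

Definition hypograph (f : X -> R) : XI := [set z | strip z /\ z.2 <= f z.1].

Definition hypograph_partition (f : X -> R) : set XI :=
  [set hypograph f; strip `\` hypograph f].

Definition common_refinement (P Q : set XI) : set XI :=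
  [set A `&` B | A in P & B in Q].

Definition collection_partition (F : seq (X -> R)) : set XI :=
  foldr (fun f => common_refinement (hypograph_partition f)) [set strip] F.

Definition cell_measure (A : XI) : R := fine ((mu \x lebesgue_measure)%E A).

(* [collection_partition F] is finite; it may contain the empty set, which
   contributes 0 since [0 * ln 0 = 0]. *)
Definition static_entropy (F : seq (X -> R)) : R :=
  - \sum_(A \in collection_partition F) cell_measure A * ln (cell_measure A).

Definition orbit_collection (T : L1 -> L1) (F : seq L1) (n : nat) : seq L1 :=
  flatten [seq [seq iter k T f | f <- F] | k <- iota 0 n].

(* The elements of L^1 are read as functions through chosen representatives;
   changing them on null sets does not affect [static_entropy]. *)
Definition entropy_wrt (T : L1 -> L1) (F : seq L1) : R :=
  limn (fun n => n%:R^-1 *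
    static_entropy (map (fun f : L1 => f : X -> R) (orbit_collection T F n))).

(* Bounded measurable functions are integrable, so that [LfunType] puts no
   restriction on the [0, 1]-valued functions. *)
Definition collection : set (seq (LfunType mu (lexx 1%E))) :=
  [set F : seq (LfunType mu (lexx 1%E)) |
    forall f, f \in F -> forall x, 0 <= f x <= 1].

Definition entropy (T : L1 -> L1) : \bar R :=
  ereal_sup [set (entropy_wrt T (map (@L1_class _ _ _ mu) F))%:E |
    F in collection].

Definition zero_entropy : set DS := [set T | entropy T = 0%E].

End doubly_stochastic.

Definition separable (T : topologicalType) : Prop :=
  exists2 D : set T, countable D & dense D.

(* A contains a countable intersection of dense open sets, i.e., the complement
   of A is meager. *)
Definition residual (T : topologicalType) (A : set T) : Prop :=
  exists2 G : set T, Gdelta_dense G & G `<=` A.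

(* Main.v *)
From HB Require Import structures.
Require Import Defs.
From mathcomp Require Import all_boot all_order all_algebra.
From mathcomp Require Import all_classical all_reals all_analysis.
From mathcomp Require Import measurable_realfun.
From mathcomp Require Import ring lra.
Import Order.TTheory GRing.Theory Num.Theory numFieldNormedType.Exports.

Set Implicit Arguments.
Unset Strict Implicit.
Unset Printing Implicit Defensive.

Local Open Scope classical_set_scope.
Local Open Scope ring_scope.

(** Let [mean] be the doubly stochastic operator mapping [f] to the constant
    function with value the integral of [f]. The proof exhibits one set of
    operators, dense and G-delta for both topologies, whose members [T] satisfy
    [T^n f --> mean f] in L^1 for every [f], and shows that such operators have
    zero entropy.

    Genericity. Let [near_mean f r] be the set of [T] such that
    [|T^n f - mean f| < r] for some [n]. Since doubly stochastic operators are
    contractions, [T |-> T^n f] is continuous as soon as all evaluations are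
    ([iter_DS_continuous]), so that [near_mean f r] is open for the strong and
    for the norm topology. It is dense for the norm, hence for the coarser
    strong topology: [S = (1 - t) T + t mean] is within [2 t] of [T], and
    [S^n f - mean f = (1 - t)^n (T^n f - mean f)] ([iter_mix_mean]). When [f]
    ranges over a countable dense set and [r] over the [1 / (m + 1)], the
    intersection of these sets consists of operators with [T^n f --> mean f] for
    every [f], because [|T^n f - mean f|] is nonincreasing in [n]
    ([cvg_iter_mean]).

    Entropy ([entropy_wrt_cvg0]). Suppose that [T^n f --> g f] for all [f] in a
    collection [F]. The hypograph of [T^k f] is recovered from the hypograph of
    [g f] and from the symmetric difference [D k f] of the two. By monotonicity
    and subadditivity of entropy, the entropy of the joint partition of
    [F, T F, ..., T^(n-1) F] is at most a constant plus the sum over [k < n] and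
    over [f] in [F] of the entropies of the two-set partitions given by [D k f].
    The measure of [D k f] is at most [|T^k f - g f|], so that the entropy of
    this two-set partition tends to 0 with [k]; dividing by [n], Cesaro's lemma
    gives the limit 0. *)

(** * Shannon entropy of finite distributions *)

Section shannon.
Context (R : realType).
Implicit Types x y : R.

(** The contribution of a cell of mass [x] to the entropy of a partition. *)
Definition eta x : R := - (x * ln x).

Lemma eta0 : eta 0 = 0. Proof. by rewrite /eta mul0r oppr0. Qed.

Lemma eta1 : eta 1 = 0. Proof. by rewrite /eta ln1 mulr0 oppr0. Qed.

Lemma eta_ge0 x : 0 <= x <= 1 -> 0 <= eta x.
Proof.
by move=> /andP[x0 x1]; rewrite /eta -mulrN mulr_ge0// oppr_ge0 ln_le0.
Qed.

Lemma ln_le_subr1 x : 0 < x -> ln x <= x - 1.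
Proof.
move=> x0; rewrite -[in ln x](subrKC 1 x); apply: le_ln1Dx.
by rewrite ltrBrDl subrr.
Qed.

(** Gibbs' inequality for one term. *)
Lemma eta_le_cross x y : 0 <= x -> 0 <= y -> (y = 0 -> x = 0) ->
  eta x <= - (x * ln y) + (y - x).
Proof.
rewrite le_eqVlt => /predU1P[<- y0 _|x0].
  by rewrite eta0 mul0r oppr0 add0r addr0.
rewrite le_eqVlt => /predU1P[<- /(_ erefl) x0'|y0 _].
  by rewrite x0' ltxx in x0.
have /(ler_wpM2l (ltW x0)) := ln_le_subr1 (divr_gt0 y0 x0).
rewrite ln_div ?posrE// !mulrBr mulr1 [x * (y / x)]mulrC divfK ?gt_eqF// /eta.
by move=> h; lra.
Qed.

(** The square root bound makes the entropy of a two-set partition vanish with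
    the mass of one of the two sets. *)
Lemma eta_le_sqrt x : 0 <= x -> eta x <= 2 * Num.sqrt x.
Proof.
move=> x0; have s0 := sqrtr_ge0 x; rewrite -[in eta x](sqr_sqrtr x0).
move: s0; set s := Num.sqrt x; rewrite le_eqVlt => /predU1P[<-|s0].
  by rewrite expr0n/= eta0 mulr0.
rewrite /eta lnXn//.
have := ln_sublinear (ltac:(by rewrite invr_gt0) : 0 < s^-1).
rewrite lnV ?posrE// => h.
have -> : - (s ^+ 2 * (ln s *+ 2)) = 2 * (s * (s * - ln s)) by ring.
rewrite ler_pM2l// ger_pMr//.
have /(ler_wpM2l (ltW s0)) := ltW h.
by rewrite divff// gt_eqF.
Qed.

Lemma eta_onem_le x : 0 <= x <= 1 -> eta (1 - x) <= x.
Proof.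
move=> /andP[x0 x1].
have := @eta_le_cross (1 - x) 1.
rewrite ln1 mulr0 oppr0 add0r opprB addrCA subrr addr0.
apply => //; first by rewrite subr_ge0.
by move=> /eqP; rewrite oner_eq0.
Qed.

Context (I J : finType).

(** Merging cells does not increase the entropy. *)
Lemma eta_sum_le (p : I -> R) (Q : pred I) : (forall i, 0 <= p i) ->
  eta (\sum_(i | Q i) p i) <= \sum_(i | Q i) eta (p i).
Proof.
move=> p0; rewrite /eta mulr_suml -sumrN; apply: ler_sum => i Qi.
rewrite lerN2; have := p0 i; rewrite le_eqVlt => /predU1P[<-|pi0].
  by rewrite !mul0r.
rewrite ler_pM2l// ler_ln ?posrE//.
  by rewrite (bigD1 i)//= lerDl sumr_ge0.
by rewrite (bigD1 i)//= ltr_pwDl// sumr_ge0.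
Qed.

(** Subadditivity: Gibbs' inequality between a joint distribution and the
    product of its marginals. *)
Lemma eta_joint_le (p : I -> J -> R) : (forall i j, 0 <= p i j) ->
  \sum_i \sum_j p i j = 1 ->
  \sum_i \sum_j eta (p i j) <=
  \sum_i eta (\sum_j p i j) + \sum_j eta (\sum_i p i j).
Proof.
move=> p0 p1; pose a i := \sum_j p i j; pose b j := \sum_i p i j.
have a0 i : 0 <= a i by apply: sumr_ge0.
have b0 j : 0 <= b j by apply: sumr_ge0.
have pa i j : p i j <= a i by rewrite /a (bigD1 j)//= lerDl sumr_ge0.
have pb i j : p i j <= b j by rewrite /b (bigD1 i)//= lerDl sumr_ge0.
have b1 : \sum_j b j = 1 by rewrite /b exchange_big.
have le_ij i j : eta (p i j) <=
    - (p i j * ln (a i)) - p i j * ln (b j) + (a i * b j - p i j).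
  have := p0 i j; rewrite le_eqVlt => /predU1P[<-|pij].
    by rewrite eta0 !mul0r oppr0 !add0r addr0 mulr_ge0.
  have ai := lt_le_trans pij (pa i j); have bj := lt_le_trans pij (pb i j).
  have := @eta_le_cross (p i j) (a i * b j) (ltW pij) (mulr_ge0 (a0 i) (b0 j)).
  rewrite lnM ?posrE// mulrDr opprD; apply.
  by move=> /eqP; rewrite mulf_eq0 (gt_eqF ai) (gt_eqF bj).
apply: (@le_trans _ _ (\sum_i \sum_j
    (- (p i j * ln (a i)) - p i j * ln (b j) + (a i * b j - p i j)))).
  by apply: ler_sum => i _; apply: ler_sum => j _; exact: le_ij.
under eq_bigr do rewrite !big_split/= !sumrN -mulr_sumr b1 mulr1 -mulr_suml.
rewrite big_split/= [X in _ + X <= _]sumrB subrr addr0 sumrB lerD//.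
rewrite sumrN exchange_big/=.
by rewrite lerN2; apply: ler_sum => j _; rewrite -mulr_suml.
Qed.

End shannon.

(** * Entropy of finite partitions of a probability space *)

Section pattern.
Context (T : Type).

(** The partition into the joint cells of a finite sequence of sets: the label
    of a point records which of the sets contain it. *)
Definition pattern (As : seq (set T)) (z : T) : (size As).-tuple bool :=
  map_tuple (fun A : set T => `[<A z>]) (in_tuple As).

Lemma patternP (As : seq (set T)) z w :
  pattern As z = pattern As w <-> forall A : set T, A \in As -> A z <-> A w.
Proof.
split=> [/(congr1 val)/= /eq_in_map zw A /zw|zw].
  by move=> /(congr1 is_true) /=; rewrite !asboolE => ->.
apply: val_inj => /=; apply/eq_in_map => A AAs /=.
by rewrite (propext (zw _ AAs)).
Qed.

End pattern.

Section label_entropy.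
Context d (Z : measurableType d) (R : realType) (P : probability Z R).

(** A partition is given by a function [L] to a finite type, its cells being
    the fibres of [L]. *)
Definition mass (I : finType) (L : Z -> I) (i : I) : R := fine (P (L @^-1` [set i])).

Definition label_entropy (I : finType) (L : Z -> I) : R := \sum_i eta (mass L i).

(** All the cells of the partition are measurable. *)
Definition measurable_label (I : finType) (L : Z -> I) :=
  forall i, measurable (L @^-1` [set i]).

Lemma mass_ge0 (I : finType) (L : Z -> I) i : 0 <= mass L i.
Proof. exact: fine_ge0. Qed.

Lemma mass_comp (I J : finType) (L : Z -> I) (g : I -> J) j :
  measurable_label L -> mass (g \o L) j = \sum_(i | g i == j) mass L i.
Proof.
move=> mL; rewrite /mass.
have -> : (g \o L) @^-1` [set j] =
    \bigcup_(i in [set i | g i = j]) (L @^-1` [set i]).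
  by apply/seteqP; split => [z /= <-|z /= [i /= <- ->]//]; exists (L z).
rewrite measure_fin_bigcup//; last by move=> i k _ _ [z [/= <- <-]].
rewrite (fsbigE (enum [pred i | g i == j])) ?enum_uniq//.
- rewrite -sum_fine// => [|i _]; last by rewrite fin_num_measure.
  rewrite big_enum_cond/=; apply: eq_bigl => i; apply/andP/eqP => [[/eqP//]|gi].
  by rewrite !inE gi.
- by move=> i /=; rewrite mem_enum => /eqP.
- by move=> i /= gi; rewrite mem_enum inE gi eqxx.
- exact: finite_finset.
Qed.

Lemma mass_sum1 (I : finType) (L : Z -> I) : measurable_label L ->
  \sum_i mass L i = 1.
Proof.
move=> /(@mass_comp _ _ L (fun=> tt) tt) => /esym.
rewrite (eq_bigl xpredT)// => ->; rewrite /mass.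
by rewrite (_ : _ @^-1` _ = setT) ?probability_setT//; apply/seteqP; split.
Qed.

Lemma mass_le1 (I : finType) (L : Z -> I) i : measurable_label L -> mass L i <= 1.
Proof.
move=> mL; rewrite /mass -lee_fin fineK ?fin_num_measure//; first exact: probability_le1.
Qed.

Lemma label_entropy_ge0 (I : finType) (L : Z -> I) : measurable_label L ->
  0 <= label_entropy L.
Proof.
by move=> mL; apply: sumr_ge0 => i _; apply: eta_ge0; rewrite mass_ge0 mass_le1.
Qed.

Lemma label_entropy_comp (I J : finType) (L : Z -> I) (g : I -> J) :
  measurable_label L -> label_entropy (g \o L) <= label_entropy L.
Proof.
move=> mL; rewrite /label_entropy [leRHS](partition_big g xpredT)//=.
by apply: ler_sum => j _; rewrite mass_comp// eta_sum_le// => i; exact: mass_ge0.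
Qed.

(** The partition of [L'] is coarser than the partition of [L]. *)
Lemma label_entropy_le (I J : finType) (L : Z -> I) (L' : Z -> J) :
  measurable_label L -> (forall z w, L z = L w -> L' z = L' w) ->
  label_entropy L' <= label_entropy L.
Proof.
move=> mL LL'.
have [z0 _] : exists z0 : Z, True.
  apply: contrapT => noZ; have := @probability_setT _ _ _ P.
  rewrite (_ : setT = set0) ?measure0; last first.
    by apply/seteqP; split => // z _; apply: noZ; exists z.
  by move=> [] /esym/eqP; rewrite oner_eq0.
(* The value of g outside the image of L is irrelevant. *)
pose g i := L' (xget z0 [set z | L z = i]).
have -> : L' = g \o L.
  apply/funext => z; apply: LL'.
  by have /= -> := @xgetPex _ z0 [set w | L w = L z] (ex_intro _ z erefl).
exact: label_entropy_comp.
Qed.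

Lemma label_entropy_pair (I J : finType) (L : Z -> I) (L' : Z -> J) :
  measurable_label (fun z => (L z, L' z)) ->
  label_entropy (fun z => (L z, L' z)) <= label_entropy L + label_entropy L'.
Proof.
move=> mLL'; set M := (X in measurable_label X) in mLL' *.
have mL i : mass L i = \sum_j mass M (i, j).
  rewrite -[L]/(fst \o M) mass_comp//
    (reindex_onto (pair i) snd)/=; last by move=> [? ?] /= /eqP ->.
  by apply: eq_bigl => j; rewrite !eqxx.
have mL' j : mass L' j = \sum_i mass M (i, j).
  rewrite -[L']/(snd \o M) mass_comp//
    (reindex_onto (pair^~ j) fst)/=; last by move=> [? ?] /= /eqP ->.
  by apply: eq_bigl => i; rewrite !eqxx.
rewrite /label_entropy.
under [X in _ <= X + _]eq_bigr do rewrite mL.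
under [X in _ <= _ + X]eq_bigr do rewrite mL'.
have -> : \sum_k eta (mass M k) = \sum_i \sum_j eta (mass M (i, j)).
  by rewrite pair_bigA; apply: eq_bigr => -[].
apply: eta_joint_le => [i j|]; first exact: mass_ge0.
by rewrite pair_bigA/= -(mass_sum1 mLL'); apply: eq_bigr => -[].
Qed.

Lemma measurable_label_pattern (As : seq (set Z)) :
  (forall A : set Z, A \in As -> measurable A) -> measurable_label (pattern As).
Proof.
move=> mAs t.
have -> : pattern As @^-1` [set t] = \bigcap_(i in [set: 'I_(size As)])
    (if tnth t i then nth set0 As i else ~` nth set0 As i).
  apply/seteqP; split => [z /= <- i _|z /= zt].
    by rewrite tnth_map (tnth_nth set0) /=; case: asboolP.
  apply: eq_from_tnth => i; rewrite tnth_map (tnth_nth set0) /=.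
  by have := zt i I; case: (tnth t i) => zi; [rewrite asboolT|rewrite asboolF].
apply: fin_bigcap_measurable => // i _.
have mi : measurable (nth set0 As i) by apply: mAs; exact: mem_nth.
by case: ifPn => // _; exact: measurableC.
Qed.

(** Entropy of the joint partition generated by a sequence of sets. *)
Definition join_entropy (As : seq (set Z)) : R := label_entropy (pattern As).

Lemma join_entropy_ge0 (As : seq (set Z)) :
  (forall A : set Z, A \in As -> measurable A) -> 0 <= join_entropy As.
Proof. by move=> mAs; exact/label_entropy_ge0/measurable_label_pattern. Qed.

(** Refining a partition does not decrease the entropy. *)
Lemma join_entropy_le (As Bs : seq (set Z)) :
  (forall B : set Z, B \in Bs -> measurable B) ->
  (forall z w, (forall B : set Z, B \in Bs -> B z <-> B w) ->
    forall A : set Z, A \in As -> A z <-> A w) ->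
  join_entropy As <= join_entropy Bs.
Proof.
move=> mBs AB; apply: label_entropy_le; first exact: measurable_label_pattern.
by move=> z w /patternP zw; apply/patternP; exact: AB zw.
Qed.

(** Entropy of the partition into a set and its complement. *)
Definition set_entropy (A : set Z) : R := eta (fine (P A)) + eta (1 - fine (P A)).

Lemma label_entropy_asbool (A : set Z) : measurable A ->
  label_entropy (fun z => `[<A z>]) = set_entropy A.
Proof.
move=> mA; rewrite /label_entropy big_bool/= /set_entropy /mass.
have -> : (fun z => `[<A z>]) @^-1` [set true] = A.
  by apply/seteqP; split => z /= /asboolP.
have -> : (fun z => `[<A z>]) @^-1` [set false] = ~` A.
  apply/seteqP; split => z /=; first by move=> /negbT/asboolP.
  exact: asboolF.
by rewrite probability_setC// fineB// fin_num_measure.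
Qed.

Lemma join_entropy_subadditive (As : seq (set Z)) :
  (forall A : set Z, A \in As -> measurable A) ->
  join_entropy As <= \sum_(A <- As) set_entropy A.
Proof.
elim: As => [_|A As IH mAs].
  rewrite big_nil /join_entropy /label_entropy (big_pred1 [tuple])/=; last first.
    by move=> t; apply/esym/eqP/val_inj; case: t => -[].
  rewrite /mass (_ : _ @^-1` _ = setT) ?probability_setT ?eta1//.
  by apply/seteqP; split => // z _ /=; rewrite tuple0.
have mAs' B : B \in As -> measurable B.
  by move=> BAs; apply: mAs; rewrite inE BAs orbT.
have mA : measurable A by apply: mAs; rewrite inE eqxx.
rewrite big_cons -label_entropy_asbool//.
apply: le_trans (lerD (lexx _) (IH mAs')).
have mp : measurable_label (fun z => (`[<A z>], pattern As z)).
  move=> [b t].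
  have -> : (fun z => (`[<A z>], pattern As z)) @^-1` [set (b, t)] =
      (if b then A else ~` A) `&` (pattern As @^-1` [set t]).
    apply/seteqP; split => z /=.
      by move=> [<- ->]; split => //; case: ifPn => /asboolP.
    by move=> [Az ->]; congr pair; case: b Az => ?; [rewrite asboolT|rewrite asboolF].
  apply: measurableI; last exact: measurable_label_pattern.
  by case: b => //; exact: measurableC.
apply: le_trans (label_entropy_pair mp).
apply: label_entropy_le => // z w zw.
have /(congr1 is_true) := congr1 fst zw; rewrite /= !asboolE => Azw.
have /patternP Aszw := congr1 snd zw; apply/(@patternP _ (A :: As)) => B.
by rewrite inE => /predU1P[->|BAs]; [split; rewrite Azw|exact: Aszw].
Qed.

Lemma set_entropy_le (A : set Z) : measurable A ->
  set_entropy A <= 2 * Num.sqrt (fine (P A)) + fine (P A).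
Proof.
move=> mA; have PA : 0 <= fine (P A) <= 1.
  by rewrite fine_ge0//= -lee_fin fineK ?fin_num_measure// probability_le1.
by rewrite /set_entropy lerD ?eta_onem_le// eta_le_sqrt// fine_ge0.
Qed.

End label_entropy.

(** * Entropy of collections of functions *)

Section cells.
Context (T : choiceType).
Implicit Types (A S : set T) (As : seq (set T)).

Lemma cell_cons S A As (b : bool) (t : (size As).-tuple bool) : A `<=` S ->
  S `&` pattern (A :: As) @^-1` [set [tuple of b :: t]] =
  (if b then A else S `\` A) `&` (S `&` pattern As @^-1` [set t]).
Proof.
move=> AS; apply/seteqP; split => z /=.
  move=> [Sz /(congr1 val)/= [<- zt]]; split; first by case: asboolP.
  by split => //; exact: val_inj.
move=> [bz [Sz zt]]; split => //; apply: val_inj => /=.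
by rewrite -zt; case: b bz => [?|[_ ?]]; [rewrite asboolT|rewrite asboolF].
Qed.

(** Refining successively by the sets of [As] and their complements in [S] gives
    the cells of the labelling [pattern As]. *)
Lemma common_refinement_cells S As : (forall A : set T, A \in As -> A `<=` S) ->
  foldr (fun A (Q : set (set T)) =>
    [set B `&` C | B in [set A; S `\` A] & C in Q]) [set S] As =
  range (fun t => S `&` pattern As @^-1` [set t]).
Proof.
elim: As => [_|A As IH AsS].
  apply/seteqP; split => [_ /= ->|_ /= [t _ <-]].
    exists [tuple] => //; apply/setIidPl => z _ /=; exact: tuple0.
  by apply/setIidPl => z _ /=; apply: val_inj; case: t => -[].
have AS : A `<=` S by apply: AsS; rewrite inE eqxx.
rewrite /= IH => [|B BAs]; last by apply: AsS; rewrite inE BAs orbT.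
apply/seteqP; split => [_ /= [B BA [_ [t _ <-] <-]]|_ /= [t _ <-]].
  case: BA => ->; [exists [tuple of true :: t]|exists [tuple of false :: t]] => //;
  exact: cell_cons.
case/tupleP: t => b t; exists (if b then A else S `\` A).
  by case: b; [left|right].
exists (S `&` pattern As @^-1` [set t]); first by exists t.
exact/esym/cell_cons.
Qed.

(** A sum over the set of cells is a sum over their labels: distinct labels give
    distinct cells, unless these are empty. *)
Lemma fsbig_fibres (R : realType) (I : finType) (L : T -> I) S (g : set T -> R) :
  g set0 = 0 ->
  \sum_(A \in range (fun i => S `&` L @^-1` [set i])) g A =
  \sum_i g (S `&` L @^-1` [set i]).
Proof.
move=> g0; pose cell i := S `&` L @^-1` [set i]; pose K := [set i | cell i !=set0].
transitivity (\sum_(A \in cell @` K) g A).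
  apply/esym/fsbig_widen; first exact: image_subset.
  move=> A [[i _ <-] /= nK]; apply: contrapT => gi; apply: nK; exists i => //.
  by apply/set0P/eqP => i0; apply: gi; rewrite -/(cell i) i0.
rewrite fsbig_image; last first.
  move=> i j _ /set_mem[z [Sz zj]] ij.
  have : cell i z by rewrite ij.
  by move=> [_ /= <-]; exact: zj.
transitivity (\sum_(i \in [set: I]) g (cell i)).
  apply: fsbig_widen => // i [_ /= iK].
  suff -> : cell i = set0 by [].
  by apply/eqP/negPn/negP => /set0P.
rewrite (fsbigE (index_enum I)) ?index_enum_uniq//.
  by apply: eq_bigl => i; rewrite in_setT.
by move=> i _; rewrite mem_index_enum.
Qed.

End cells.

Section static_entropy.
Context d (X : measurableType d) (R : realType) (mu : probability X R).
Local Notation XI := (X * measurableTypeR R)%type.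
Local Notation strip := (@strip d X R).
Local Notation hypograph := (@hypograph d X R).

Lemma measurable_strip : measurable strip.
Proof.
have -> : strip = [set: X] `*` [set` `[0, 1]] :> set XI.
  by apply/seteqP; split => z; rewrite /Defs.strip/= in_itv/=; [move=> ?; split|case].
by apply: measurableX => //; exact: (@measurable_itv R).
Qed.

Lemma measurable_hypograph (f : X -> R) : measurable_fun [set: X] f ->
  measurable (hypograph f).
Proof.
move=> mf; apply: (@measurable_fun_le _ XI R strip snd (f \o fst)).
- exact: measurable_strip.
- exact: measurable_funTS measurable_snd.
- by apply: measurable_funTS; exact: (measurableT_comp mf measurable_fst).
Qed.

(** The product measure on [X * [0, 1]], as a probability on [X * R]. *)
Definition strip_measure : set XI -> \bar R :=
  mrestr (mu \x lebesgue_measure)%E measurable_strip.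

HB.instance Definition _ := Measure.on strip_measure.

Lemma strip_measureT : strip_measure setT = 1%E.
Proof.
rewrite /strip_measure /mrestr setTI.
have -> : strip = [set: X] `*` [set` `[0, 1]] :> set XI.
  by apply/seteqP; split => z; rewrite /Defs.strip/= in_itv/=; [move=> ?; split|case].
rewrite product_measure1E//.
transitivity (1 * 1 : \bar R)%E; last by rewrite mule1.
congr (_ * _)%E; first exact: probability_setT.
by rewrite [LHS]lebesgue_measure_itv/= lte_fin ltr01 oppr0 adde0.
Qed.

HB.instance Definition _ :=
  Measure_isProbability.Build _ _ _ strip_measure strip_measureT.

Lemma static_entropyE (F : seq (X -> R)) :
  static_entropy mu F = join_entropy strip_measure (map hypograph F).
Proof.
rewrite /static_entropy /join_entropy /label_entropy.
have -> : collection_partition F = 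
    range (fun t => strip `&` pattern (map hypograph F) @^-1` [set t]).
  rewrite -common_refinement_cells; first by rewrite foldr_map.
  by move=> A /mapP[f _ ->] z [].
rewrite fsbig_fibres; last by rewrite /cell_measure measure0 mul0r.
rewrite -sumrN; apply: eq_bigr => t _.
by rewrite /eta /cell_measure /mass/= /strip_measure /mrestr setIC.
Qed.

(** The section at [x] of the symmetric difference lies between [f x] and
    [g x]. *)
Lemma strip_measure_hypographY_le (f g : X -> R) :
  measurable_fun [set: X] f -> measurable_fun [set: X] g ->
  (strip_measure (hypograph f `+` hypograph g) <= \int[mu]_x `|f x - g x|%:E)%E.
Proof.
move=> mf mg; set D := hypograph f `+` hypograph g.
have mD : measurable D.
  by apply: measurableU; apply: measurableD; exact: measurable_hypograph.
have mDs : measurable (D `&` strip) by apply: measurableI => //; exact: measurable_strip.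
rewrite /strip_measure /mrestr /product_measure1; apply: ge0_le_integral => //.
- exact: measurable_fun_xsection.
- by apply/measurable_EFinP; apply: measurableT_comp => //; exact: measurable_funB.
move=> x _ /=.
pose a := Num.min (f x) (g x); pose b := Num.max (f x) (g x).
apply: (@le_trans _ _ (lebesgue_measure [set` `]a, b]])).
  apply: le_measure; rewrite ?inE.
  - exact: measurable_xsection.
  - exact: (@measurable_itv R).
  move=> t /xsectionP/= [D_xt _]; rewrite /= in_itv/= /a /b gt_min le_max.
  case: D_xt => -[[/= s tle] /= nt]; rewrite tle ?orbT andbT ltNge; apply/orP.
    by right; rewrite ltNge; apply/negP => ?; apply: nt.
  by left; apply/negP => ?; apply: nt.
rewrite [leLHS]lebesgue_measure_itv/= lte_fin; case: ifPn => // _.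
rewrite -EFinB lee_fin /a /b; case: (leP (f x) (g x)) => fg.
  by rewrite distrC; exact: ler_norm.
exact: ler_norm.
Qed.

End static_entropy.

(** * Vanishing entropy along convergent iterates *)

(** Membership in [B] and in the symmetric difference determines membership
    in [A]. *)
Lemma setY_iff (T : Type) (A B : set T) z w :
  ((A `+` B) z <-> (A `+` B) w) -> (B z <-> B w) -> (A z <-> A w).
Proof.
rewrite /setY /setD /setU /=.
have := EM (A z); have := EM (B z); have := EM (A w); have := EM (B w); tauto.
Qed.

Section convergent_iterates.
Context d (X : measurableType d) (R : realType) (mu : probability X R).
Local Notation L1 := (LspaceType1 mu).
Local Notation hyp u := (@hypograph d X R (u : L1)).
Implicit Types (T g : L1 -> L1) (F : seq L1) (u v : L1).

Lemma L1_norm_subE u v : `|u - v|%:E = (\int[mu]_x `|u x - v x|%:E)%E.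
Proof.
have abs_meas (w : X -> R) : measurable_fun [set: X] w ->
    measurable_fun [set: X] (fun x => `|w x|%:E).
  by move=> mw; apply/measurable_EFinP; exact: measurableT_comp.
rewrite EFin_L1_norm; apply: ge0_ae_eq_integral => //.
- exact/abs_meas/measurable_L1.
- by apply: abs_meas; apply: measurable_funB; exact: measurable_L1.
near=> x => _ /=; congr (`| _ |%:E).
rewrite [LHS](near (L1_addE u (- v)) x)//.
by rewrite [X in _ + X](near (L1_oppE v) x).
Unshelve. all: by end_near. Qed.

Lemma measurable_hypograph_L1 u : measurable (hyp u).
Proof. by apply: measurable_hypograph; exact: measurable_L1. Qed.

Lemma set_entropy_hypographY_le u v :
  set_entropy (strip_measure mu) (hyp u `+` hyp v) <=
  2 * Num.sqrt `|u - v| + `|u - v|.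
Proof.
have mD : measurable (hyp u `+` hyp v).
  by apply: measurableU; apply: measurableD; exact: measurable_hypograph_L1.
have D_le : fine (strip_measure mu (hyp u `+` hyp v)) <= `|u - v|.
  rewrite -lee_fin fineK ?fin_num_measure// L1_norm_subE.
  by apply: strip_measure_hypographY_le; exact: measurable_L1.
by apply: le_trans (set_entropy_le _ mD) _; rewrite lerD// ler_pM2l// ler_wsqrtr.
Qed.

(** Each hypograph of [T^k f] is recovered from the hypograph of a fixed [g f]
    and from the symmetric difference of the two. *)
Lemma static_entropy_orbit_le T g F n :
  static_entropy mu (map (fun f : L1 => f : X -> R) (orbit_collection T F n)) <=
  \sum_(f <- F) set_entropy (strip_measure mu) (hyp (g f)) +
  \sum_(0 <= k < n) \sum_(f <- F)
    (2 * Num.sqrt `|iter k T f - g f| + `|iter k T f - g f|).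
Proof.
rewrite static_entropyE -map_comp.
pose D k f := hyp (iter k T f) `+` hyp (g f).
pose As := [seq hyp (g f) | f <- F] ++
  flatten [seq [seq D k f | f <- F] | k <- iota 0 n].
have mAs A : A \in As -> measurable A.
  rewrite mem_cat => /orP[/mapP[f _ ->]|/flattenP[s /mapP[k _ ->] /mapP[f _ ->]]].
    exact: measurable_hypograph_L1.
  by apply: measurableU; apply: measurableD; exact: measurable_hypograph_L1.
apply: (@le_trans _ _ (join_entropy (strip_measure mu) As)).
  apply: join_entropy_le => // z w zw A /mapP[h /flattenP[s /mapP[k kn ->]]].
  move=> /mapP[f fF ->] ->.
  have : hyp (g f) z <-> hyp (g f) w.
    by apply: zw; rewrite mem_cat; apply/orP; left; apply/mapP; exists f.
  have : D k f z <-> D k f w.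
    apply: zw; rewrite mem_cat; apply/orP; right; apply/flattenP.
    by exists [seq D k f | f <- F]; apply/mapP; [exists k|exists f].
  exact: setY_iff.
apply: le_trans (join_entropy_subadditive _ mAs) _.
rewrite big_cat big_map lerD2l big_flatten big_map /index_iota subn0.
apply: ler_sum => k _; rewrite big_map; apply: ler_sum => f _.
exact: set_entropy_hypographY_le.
Qed.

(** If the iterates of each function of the collection converge in L^1, then the
    entropy along the collection vanishes. The existence of the limit defining
    [entropy_wrt] is part of the proof. *)
Lemma entropy_wrt_cvg0 T g F :
  (forall f, f \in F -> `|iter k T f - g f| @[k --> \oo] --> (0 : R)) ->
  entropy_wrt T F = 0.
Proof.
move=> Tg.
pose H n := static_entropy mu (map (fun f : L1 => f : X -> R) (orbit_collection T F n)).
pose C := \sum_(f <- F) set_entropy (strip_measure mu) (hyp (g f)).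
pose e k := \sum_(f <- F) (2 * Num.sqrt `|iter k T f - g f| + `|iter k T f - g f|).
have e0 : e @ \oo --> (0 : R).
  pose s f k := 2 * Num.sqrt `|iter k T f - g f| + `|iter k T f - g f|.
  have s0 f : f \in F -> s f @ \oo --> (0 : R).
    move=> /Tg f0; have -> : (0 : R) = 2 * Num.sqrt 0 + 0 by rewrite sqrtr0 mulr0 addr0.
    apply: cvgD => //; apply: cvgM; first exact: cvg_cst.
    by apply: cvg_comp f0 _; exact: sqrt_continuous.
  rewrite -[e]/(fun k => \sum_(f <- F) s f k).
  elim: F s0 {Tg H C e} => [_|f F IH s0].
    have -> : (fun k => \sum_(f <- [::]) s f k) = cst 0.
      by apply/funext => k; rewrite big_nil.
    exact: cvg_cst.
  have -> : (fun k => \sum_(h <- f :: F) s h k) =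
      (fun k => s f k + \sum_(h <- F) s h k).
    by apply/funext => k; rewrite big_cons.
  rewrite -[X in _ --> X]addr0; apply: cvgD; first by apply: s0; rewrite inE eqxx.
  by apply: IH => h hF; apply: s0; rewrite inE hF orbT.
apply: cvg_lim => //; rewrite -cvg_shiftS /=.
apply: (@squeeze_cvgr _ _ _ _ (fun=> 0) (fun n => C * n.+1%:R^-1 + arithmetic_mean e n)).
- apply: nearW => n; apply/andP; split.
    rewrite mulr_ge0 ?invr_ge0// static_entropyE join_entropy_ge0// => A.
    by move=> /mapP[_ /mapP[f _ ->] ->]; exact: measurable_hypograph_L1.
  rewrite mulrC /arithmetic_mean /= [n.+1%:R^-1 * _]mulrC -mulrDl.
  by rewrite ler_wpM2r ?invr_ge0//; exact: static_entropy_orbit_le.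
- exact: cvg_cst.
- rewrite -[X in _ --> X]addr0; apply: cvgD; last exact: cesaro.
  rewrite -[X in _ --> X](mulr0 C); apply: cvgM; first exact: cvg_cst.
  exact: cvg_harmonic.
Qed.

End convergent_iterates.

(** * The averaging operator and convex combinations *)

Section averaging.
Context d (X : measurableType d) (R : realType) (mu : probability X R).
Local Notation L1 := (LspaceType1 mu).
Local Notation DS := (DS mu).
Implicit Types (S T : DS) (u v f : L1).

Lemma DS_linear T : linear T. Proof. by have [] := DS_ds T. Qed.

Lemma DS_ge0 T f : (\forall x \ae mu, 0 <= f x) -> \forall x \ae mu, 0 <= T f x.
Proof. by have [_ + _ _] := DS_ds T; apply. Qed.

Lemma DS_one T : T (L1_one mu) = L1_one mu. Proof. by have [] := DS_ds T. Qed.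

Lemma DS_int T f : \int[mu]_x T f x = \int[mu]_x f x.
Proof. by have [_ _ _] := DS_ds T. Qed.

(** A doubly stochastic operator, bundled as a linear map. *)
Definition DS_lin T : {linear L1 -> L1} :=
  HB.pack (T : L1 -> L1)
    (GRing.isLinear.Build _ _ _ _ (T : L1 -> L1) (DS_linear T)).

Lemma DS_Z T a u : T (a *: u) = a *: T u.
Proof. exact: (linearZ_LR (DS_lin T)). Qed.

Lemma DS_B T u v : T (u - v) = T u - T v.
Proof. exact: (linearB (DS_lin T)). Qed.

Lemma DS_lipschitz T u v : `|T u - T v| <= `|u - v|.
Proof. by rewrite -DS_B; exact: DS_contraction. Qed.

Lemma L1_int_linear a u v :
  \int[mu]_x (a *: u + v) x = a * \int[mu]_x u x + \int[mu]_x v x.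
Proof.
have mL (w : L1) : measurable_fun [set: X] (EFin \o w).
  by apply/measurable_EFinP; exact: measurable_L1.
have iau : mu.-integrable [set: X] (EFin \o (fun x => a * u x)).
  rewrite (_ : _ \o _ = (fun x => a%:E * (EFin \o u) x)%E).
    exact/integrableZl/L1_integrable.
  by apply/funext => x; rewrite /= EFinM.
rewrite -RintegralZl//; last exact: L1_integrable.
rewrite -RintegralD//; last exact: L1_integrable.
rewrite /Rintegral; congr fine; apply: ae_eq_integral => //; first exact: mL.
  apply/measurable_EFinP; apply: measurable_funD; last exact: measurable_L1.
  by apply: measurable_funM => //; exact: measurable_L1.
near=> x => _ /=; congr EFin.
rewrite [LHS](near (L1_addE (a *: u) v) x)//.
by rewrite [X in X + _](near (L1_scaleE a u) x).
Unshelve. all: by end_near. Qed.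

Lemma L1_int_ge0 u : (\forall x \ae mu, 0 <= u x) -> 0 <= \int[mu]_x u x.
Proof.
move=> u0; have mu_u := measurable_L1 u.
have -> : \int[mu]_x u x = \int[mu]_x `|u x|.
  rewrite /Rintegral; congr fine; apply: ae_eq_integral => //.
  - exact/measurable_EFinP.
  - by apply/measurable_EFinP; exact: measurableT_comp.
  - by apply: filterS u0 => x u0 _ /=; rewrite ger0_norm.
by apply: Rintegral_ge0 => x _.
Qed.

Lemma L1_oneE : \forall x \ae mu, L1_one mu x = 1.
Proof.
have := L1_classE (Lfun_Sub (lexx 1%E) (Lfun_cst mu 1 1)).
by apply: filterS => x /(_ I) ->.
Qed.

Lemma L1_int_one : \int[mu]_x L1_one mu x = 1.
Proof.
transitivity (\int[mu]_(x in [set: X]) (1 : R)).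
  rewrite /Rintegral; congr fine; apply: ae_eq_integral => //.
  - by apply/measurable_EFinP; exact: measurable_L1.
  - by apply: filterS L1_oneE => x /= -> _.
by rewrite Rintegral_cst// mul1r [X in fine X](_ : _ = 1%E)//; exact: probability_setT.
Qed.

Lemma L1_intZ a u : \int[mu]_x (a *: u) x = a * \int[mu]_x u x.
Proof.
have := L1_int_linear 1 (0 : L1) 0; rewrite scale1r addr0 mul1r => h.
have i0 : \int[mu]_x (0 : L1) x = 0 by lra.
by have := L1_int_linear a u 0; rewrite addr0 i0 addr0.
Qed.

Lemma doubly_stochastic_mean :
  doubly_stochastic (fun f : L1 => (\int[mu]_x f x) *: L1_one mu).
Proof.
split=> [a u v|f f0||f].
- by rewrite L1_int_linear scalerDl scalerA.
- near=> x.
  rewrite [X in 0 <= X](near (L1_scaleE (\int[mu]_x f x) (L1_one mu)) x)//.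
  by rewrite (near L1_oneE x)// mulr1 L1_int_ge0.
- by rewrite L1_int_one scale1r.
- by rewrite L1_intZ L1_int_one mulr1.
Unshelve. all: by end_near. Qed.

(** Integration, as an operator onto the constants. *)
Definition mean : DS := MkDS doubly_stochastic_mean.

Lemma mean_DS T f : mean (T f) = mean f.
Proof. by rewrite /mean/= DS_int. Qed.

Lemma DS_mean T f : T (mean f) = mean f.
Proof. by rewrite /mean/= DS_Z DS_one. Qed.

Lemma doubly_stochastic_convex S T t : 0 <= t <= 1 ->
  doubly_stochastic (fun f : L1 => (1 - t) *: S f + t *: T f).
Proof.
move=> /andP[t0 t1]; split=> [a u v|f f0||f].
- rewrite !DS_linear !scalerDr !scalerA ![_ * a]mulrC -!scalerA.
  by rewrite addrACA -!scalerDr.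
- have Sf := DS_ge0 S f0; have Tf := DS_ge0 T f0; near=> x.
  rewrite [X in 0 <= X](near (L1_addE ((1 - t) *: S f) (t *: T f)) x)//.
  rewrite [X in 0 <= X + _](near (L1_scaleE (1 - t) (S f)) x)//.
  rewrite [X in 0 <= _ + X](near (L1_scaleE t (T f)) x)//.
  apply: addr_ge0; apply: mulr_ge0; rewrite ?subr_ge0//.
    exact: (near Sf x).
  exact: (near Tf x).
- by rewrite !DS_one -scalerDl subrK scale1r.
- by rewrite L1_int_linear L1_intZ !DS_int -mulrDl subrK mul1r.
Unshelve. all: by end_near. Qed.

(** The convex combination [(1 - t) S + t T]. *)
Definition DS_convex S T t (t01 : 0 <= t <= 1) : DS :=
  MkDS (doubly_stochastic_convex S T t01).

Lemma DS_convexE S T t (t01 : 0 <= t <= 1) f :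
  DS_convex S T t01 f = (1 - t) *: S f + t *: T f.
Proof. by []. Qed.

Lemma iter_DS_mean T n f : iter n T (mean f) = mean f.
Proof. by elim: n => //= n ->; exact: DS_mean. Qed.

Lemma mean_iter T n f : mean (iter n T f) = mean f.
Proof. by elim: n => [//|n IH]; rewrite iterS mean_DS. Qed.

Lemma iter_DS_lipschitz T n u v : `|iter n T u - iter n T v| <= `|u - v|.
Proof. by elim: n => //= n IH; apply: le_trans IH; exact: DS_lipschitz. Qed.

(** Mixing with [mean] damps the deviation from the mean geometrically. *)
Lemma iter_mix_mean T t (t01 : 0 <= t <= 1) n f :
  iter n (DS_convex T mean t01) f - mean f = (1 - t) ^+ n *: (iter n T f - mean f).
Proof.
elim: n => [|n IH]; first by rewrite expr0 scale1r.
rewrite /iter -!/(iter n _ _) -(DS_mean (DS_convex T mean t01) f) -DS_B IH DS_Z.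
rewrite exprSr -scalerA [in RHS]DS_mean; congr (_ *: _).
have m0 : mean (iter n T f - mean f) = 0 by rewrite DS_B mean_iter DS_mean subrr.
by rewrite DS_convexE m0 scaler0 addr0 DS_B DS_mean.
Qed.

End averaging.

(** * Genericity of convergence to the mean *)

Section genericity.
Context d (X : measurableType d) (R : realType) (mu : probability X R).
Local Notation L1 := (LspaceType1 mu).
Local Notation DS := (DS mu).
Implicit Types (S T : DS) (u v f : L1).

Lemma DS_0 T : T 0 = 0.
Proof. by rewrite -(scale0r (0 : L1)) DS_Z !scale0r. Qed.

Lemma DS_dist_norm S T f : `|S f - T f| <= DS_dist S T * `|f|.
Proof.
have [->|f0] := eqVneq f 0; first by rewrite !DS_0 subrr normr0 mulr0.
have nf0 : 0 < `|f| by rewrite normr_gt0.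
have : `|S (`|f|^-1 *: f) - T (`|f|^-1 *: f)| <= DS_dist S T.
  by apply: DS_dist_ub; rewrite normrZ normfV normr_id mulVf ?gt_eqF.
by rewrite !DS_Z -scalerBr normrZ normfV normr_id mulrC ler_pdivrMr.
Qed.

Lemma DS_norm_eval_continuous f : continuous (fun T : DS_norm mu => (T : DS) f).
Proof.
move=> T; have FT := nbhs_filter (T : DS_norm mu).
apply/(@cvgrPdist_lt _ L1 _ _ FT) => e e0.
have e1 : 0 < e / (`|f| + 1) by rewrite divr_gt0// ltr_wpDl.
near=> S; apply: le_lt_trans (DS_dist_norm _ _ _) _.
have TS : DS_dist T S < e / (`|f| + 1).
  by near: S; apply/nbhs_ballP; exists (e / (`|f| + 1)).
apply: (@le_lt_trans _ _ (DS_dist T S * (`|f| + 1))).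
  rewrite ler_wpM2l ?lerDl// (le_trans _ (@DS_dist_ub _ _ _ _ T S 0 _)) ?normr0//.
by rewrite -ltr_pdivlMr// ltr_wpDl.
Unshelve. all: by end_near. Qed.

Lemma DS_strong_eval_continuous f : continuous (fun T : DS_strong mu => (T : DS) f).
Proof.
move=> T; apply: (@continuous_comp _ _ _
  (fun T : DS_strong mu => (T : DS) : {ptws L1 -> L1})
  (fun g : {ptws L1 -> L1} => g f)).
  exact: initial_continuous.
exact: (@proj_continuous _ (fun=> L1) f).
Qed.

Lemma DS_norm_strong_continuous :
  continuous (fun T : DS_norm mu => (T : DS) : DS_strong mu).
Proof.
apply: continuous_comp_initial => T.
have FT := nbhs_filter (T : DS_norm mu).
apply/(@pointwise_cvgP L1 L1 _ _ (fmap_filter _ FT)) => f.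
exact: DS_norm_eval_continuous.
Qed.

(** Composition is jointly continuous on contractions. *)
Lemma iter_DS_continuous (A : topologicalType) (phi : A -> DS) :
  (forall f, continuous (fun a => phi a f)) ->
  forall n f, continuous (fun a => iter n (phi a) f).
Proof.
move=> phi_cont n f a; elim: n => [|n IH]; first exact: cvg_cst.
apply/cvgrPdist_lt => e e0; rewrite /=; set h := iter n (phi a) f in IH *.
near=> b.
rewrite (le_lt_trans (ler_distD (phi b h) _ _))// [e]splitr ltrD//.
  near: b; have /cvgrPdist_lt := @phi_cont h a; apply; exact: divr_gt0.
apply: le_lt_trans (DS_lipschitz _ _ _) _.
near: b; move/cvgrPdist_lt: IH; apply; exact: divr_gt0.
Unshelve. all: by end_near. Qed.

(** The operators having some iterate that maps [f] within [r] of its mean. *)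
Definition near_mean (f : L1) (r : R) : set DS :=
  [set T : DS | exists n, `|iter n T f - mean mu f| < r].

Lemma open_near_mean (A : topologicalType) (phi : A -> DS) f r :
  (forall g, continuous (fun a => phi a g)) -> open (phi @^-1` near_mean f r).
Proof.
move=> phi_cont.
have -> : phi @^-1` near_mean f r =
    \bigcup_n (fun a => `|iter n (phi a) f - mean mu f|) @^-1` [set x | x < r].
  by apply/seteqP; split => a /= [n]; exists n.
apply: bigcup_open => n _; apply: open_comp; last exact: open_lt.
move=> a _; apply: (@cvg_norm _ L1); apply: cvgB; last exact: cvg_cst.
exact: iter_DS_continuous.
Qed.

Lemma dense_near_mean_norm f r : 0 < r ->
  dense (near_mean f r : set (DS_norm mu)).
Proof.
move=> r0 O [T OT] oO.
have /nbhs_ballP[e /= e0 TeO] : nbhs T O by exact: open_nbhs_nbhs.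
(* Mixing T with the mean in proportion t moves T by at most 2 t <= e / 2. *)
pose t := Num.min 1 (e / 4).
have t0 : 0 < t by rewrite lt_min ltr01 divr_gt0.
have t1 : t <= 1 by rewrite ge_min lexx.
have t01 : 0 <= t <= 1 by rewrite (ltW t0).
pose S := DS_convex T (mean mu) t01.
exists S; split.
  apply: TeO; rewrite /ball/=; apply: (@le_lt_trans _ _ (e / 2)); last first.
    by rewrite ltr_pdivrMr// ltr_pMr// ltr1n.
  apply: DS_dist_le => g g1; rewrite DS_convexE.
  have -> : T g - ((1 - t) *: T g + t *: mean mu g) = t *: (T g - mean mu g).
    by rewrite scalerBl scale1r scalerBr opprD opprB addrA subrKC.
  rewrite normrZ gtr0_norm//.
  apply: (@le_trans _ _ (e / 4 * 2)); last by lra.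
  apply: ler_pM => //; [exact: ltW|by rewrite ge_min lexx orbT|].
  exact: DS_dist_le2.
have : (1 - t) ^+ n * (`|f - mean mu f|) @[n --> \oo] --> (0 : R).
  rewrite -[X in _ --> X](mul0r `|f - mean mu f|); apply: cvgM; last exact: cvg_cst.
  by apply: cvg_expr; rewrite ger0_norm ?subr_ge0// ltrBlDr ltrDl.
move=> /cvgrPdist_lt /(_ _ r0)[N _ /(_ N (leqnn N))].
rewrite /= sub0r normrN => rN; exists N; apply: le_lt_trans rN.
rewrite iter_mix_mean normrZ normrM normr_id ler_wpM2l//.
by rewrite -[X in _ - X](iter_DS_mean T N) iter_DS_lipschitz.
Qed.

(** The strong topology is coarser than the norm topology. *)
Lemma dense_near_mean_strong f r : 0 < r ->
  dense (near_mean f r : set (DS_strong mu)).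
Proof.
move=> r0 O [T OT] oO.
have := @dense_near_mean_norm f r r0 
  ((fun T : DS_norm mu => (T : DS) : DS_strong mu) @^-1` O).
case; first by exists T.
  by apply: open_comp => // S _; exact: DS_norm_strong_continuous.
by move=> S [OS nS]; exists S.
Qed.

(** Testing on a dense set, and for one iterate at each precision, suffices since
    the distance to the mean is nonincreasing along the orbit. *)
Lemma cvg_iter_mean (D : set L1) T : dense D ->
  (forall f m, D f -> near_mean f m.+1%:R^-1 T) ->
  forall f, `|iter n T f - mean mu f| @[n --> \oo] --> (0 : R).
Proof.
move=> dD TD f; apply/cvgrPdist_lt => e e0.
have e3 : 0 < e / 3 by rewrite divr_gt0.
have [|g [fg Dg]] := dD (ball f (e / 3)) _ (ball_open _ _).
  by exists f; exact: ballxx.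
have {fg} : `|f - g| < e / 3 by move: fg; rewrite -ball_normE.
move=> fg.
have [m me] : exists m, m.+1%:R^-1 < e / 3.
  by have [m _ /(_ m (leqnn m))] := near_infty_natSinv_lt (PosNum e3); exists m.
have [N TN] := TD g m Dg.
near=> n; have Nn : (N <= n)%N by near: n; exact: nbhs_infty_ge.
rewrite sub0r normrN normr_id.
apply: le_lt_trans (ler_distD (iter n T g) _ _) _.
have -> : e = e / 3 + (e / 3 + e / 3) by lra.
apply: ltrD; first exact: le_lt_trans (iter_DS_lipschitz _ _ _ _) fg.
apply: le_lt_trans (ler_distD (mean mu g) _ _) _.
apply: ltrD; last by apply: le_lt_trans (DS_lipschitz _ _ _) _; rewrite distrC.
apply: le_lt_trans (lt_trans TN me).
rewrite -(subnK Nn) iterD -[X in `|_ - X|](iter_DS_mean T (n - N)).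
exact: iter_DS_lipschitz.
Unshelve. all: by end_near. Qed.

Lemma entropy_eq0 T : (forall f, `|iter n T f - mean mu f| @[n --> \oo] --> (0 : R)) ->
  entropy T = 0%E.
Proof.
move=> Tf; rewrite /entropy.
have -> : [set (entropy_wrt T [seq L1_class i | i <- F])%:E |
    F in collection (mu := mu)] = [set 0%E].
  apply/seteqP; split => [_ [F _ <-]|_ ->].
    by rewrite (entropy_wrt_cvg0 (g := mean mu)).
  exists [::]; first by move=> f; rewrite in_nil.
  by rewrite (entropy_wrt_cvg0 (g := mean mu)).
by rewrite ereal_sup1.
Qed.

(** Both topologies are instances: all that matters is that evaluations are
    continuous and that the sets [near_mean] are dense. *)
Lemma residual_zero_entropy (A : topologicalType) (phi : A -> DS) :
  separable L1 ->
  (forall f, continuous (fun a => phi a f)) ->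
  (forall f r, 0 < r -> dense (phi @^-1` near_mean f r)) ->
  residual (phi @^-1` @zero_entropy d X R mu).
Proof.
move=> [D /countable_injP[code codeI] dD] phi_cont phi_dense.
(* e enumerates D, the remaining indices being sent to arbitrary values. *)
pose e j := xget (0 : L1) [set f | D f /\ code f = j].
have eK f : D f -> e (code f) = f.
  move=> Df; rewrite /e; case: xgetP => [g _ [Dg gf]|/(_ f)[]//].
  by apply: codeI => //; exact/mem_set.
pose V i := let: (j, m) := odflt (0, 0)%N (unpickle i) in
  phi @^-1` near_mean (e j) m.+1%:R^-1.
exists (\bigcap_i V i).
  exists V => // i; rewrite /V; case: (odflt _ _) => j m.
  by split; [exact: open_near_mean|apply: phi_dense; rewrite invr_gt0].
move=> a Va; apply: entropy_eq0; apply: (cvg_iter_mean dD) => f m Df.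
by have := Va (pickle (code f, m)) I; rewrite /V pickleK/= eK.
Qed.

End genericity.

Theorem theorem3p5 (d : measure_display) (X : measurableType d) (R : realType)
    (mu : probability X R) (L1_separable : separable (LspaceType1 mu)) :
  @residual (DS_strong mu) (@zero_entropy d X R mu) /\
  @residual (DS_norm mu) (@zero_entropy d X R mu).
Proof.
split.
- apply: (@residual_zero_entropy _ _ _ _ (DS_strong mu) id) => // [f|f r r0].
    exact: DS_strong_eval_continuous.
  exact: dense_near_mean_strong.
- apply: (@residual_zero_entropy _ _ _ _ (DS_norm mu) id) => // [f|f r r0].
    exact: DS_norm_eval_continuous.
  exact: dense_near_mean_norm.
Qed.
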